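(* Let $d, s \geq 1$ be integers, and let $N_d(s)$ denote the number of partitions into distinct parts that are simultaneously $s$-core and $(ds-1)$-core. Then $N_d(1) = 1$, $N_d(2) = d$, and for all $s \geq 3$, $$N_d(s) = N_d(s-1) + d\, N_d(s-2).$$
   Context: A partition $\lambda = (\lambda_1, \ldots, \lambda_\ell)$ is a finite weakly decreasing sequence of positive integers (the empty partition is allowed). Its Young diagram is a left-justified array of cells with $\lambda_i$ cells in row $i$. The hook of a cell $u$ consists of $u$ together with all cells to the right of $u$ in its row and all cells below $u$ in its column; the hook length of $u$ is the number of cells in its hook. For a positive integer $t$, $\lambda$ is $t$-core if no cell of $\lambda$ has hook length equal to $t$; it is $(t_1, \ldots, t_r)$-core if it is $t_i$-core for every $i$. A partition into distinct parts is one with $\lambda_1 > \lambda_2 > \cdots > \lambda_\ell$. *)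

(* Defs.v *)
From mathcomp Require Import all_boot.
From mathcomp Require Import finmap.
From mathcomp Require Import classical_sets cardinality.

Set Implicit Arguments.
Unset Strict Implicit.
Unset Printing Implicit Defensive.

Local Open Scope nat_scope.

Definition is_partition (la : seq nat) : bool := sorted geq la && (0 \notin la).

Definition distinct_parts (la : seq nat) : bool := sorted gtn la.

(* Cells are (row, column), both counted from 0, rows going downwards. *)
Definition young_diagram (la : seq nat) : seq (nat * nat) :=
  [seq (i, j) | i <- iota 0 (size la), j <- iota 0 (nth 0 la i)].

Definition hook (la : seq nat) (u : nat * nat) : seq (nat * nat) :=
  [seq v <- young_diagram la |
    ((v.1 == u.1) && (u.2 <= v.2)) || ((v.2 == u.2) && (u.1 <= v.1))].

Definition hook_length (la : seq nat) (u : nat * nat) : nat := size (hook la u).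

(* [is_core 0] holds of every partition, as hook lengths are positive. *)
Definition is_core (t : nat) (la : seq nat) : bool :=
  all (fun u => hook_length la u != t) (young_diagram la).

Definition distinct_cores (d s : nat) : set (seq nat) :=
  [set la | [/\ is_partition la, distinct_parts la,
                is_core s la & is_core (d * s - 1) la]]%classic.

(* [fset_set] is empty on infinite sets, so this is the intended count only
   together with [finite_set (distinct_cores d s)]. *)
Definition N (d s : nat) : nat := #|` fset_set (distinct_cores d s)|.

(* Main.v *)
(* Let X be the set of first-column hook lengths (beta-numbers) of a partition.
   A partition is t-core iff X is stable under x |-> x - t for x >= t, and it has
   distinct parts iff X has no two consecutive elements. An s-core is therefore
   determined by the numbers c_r of elements of X in the residue classes
   r = 1, ..., s - 1 modulo s, distinctness says that no two adjacent c_r are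
   nonzero, and the (ds-1)-core condition then only says that X lies below
   ds - 1, i.e. c_r <= d for all r and c_(s-1) < d. Splitting the words
   (c_1, ..., c_(s-1)) according to whether c_1 = 0 gives the recurrence. *)
Require Import Defs.
From mathcomp Require Import all_boot.
From mathcomp Require Import finmap.
From mathcomp Require Import classical_sets cardinality.
From mathcomp Require Import zify.

Set Implicit Arguments.
Unset Strict Implicit.
Unset Printing Implicit Defensive.

(** * Beta-numbers, hook lengths and cores *)

Fixpoint beta (la : seq nat) : seq nat :=
  if la is a :: la' then a + size la' :: beta la' else [::].

Lemma size_beta la : size (beta la) = size la.
Proof. by elim: la => //= a la ->. Qed.

Lemma count_le_all (la : seq nat) a j :
  all (geq a) la -> a <= j -> count (geq j) la = size la.
Proof.
move=> Ha aj; apply/eqP; rewrite -all_count; apply: sub_all Ha => x /=; lia.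
Qed.

Lemma sorted_geq_cons (a : nat) la :
  sorted geq (a :: la) -> all (geq a) la /\ sorted geq la.
Proof.
move=> H; split; last exact: path_sorted H.
by apply: order_path_min H => x y z /=; lia.
Qed.

(** Number the unit steps of the boundary path of the diagram from the bottom left, starting at [0].
    Vertical steps sit at the beta-numbers; the horizontal step of column [j] comes after [j]
    horizontal steps and one vertical step for each part at most [j]. *)
Lemma notin_betaP la y : sorted geq la ->
  y \notin beta la <-> exists j, y = j + count (geq j) la.
Proof.
elim: la y => [|a la IH] y; first by split=> // _; exists y; rewrite /= addn0.
move=> /sorted_geq_cons[Ha /IH {}IH] /=; rewrite inE negb_or; split.
  case/andP=> /eqP yN /IH [j yE].
  have [jlt|] := ltnP j a; first by exists j; lia.
  move=> aj; have E := count_le_all Ha aj.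
  have {}aj : a < j by lia.
  exists j.-1; rewrite (@count_le_all la a j.-1 Ha); lia.
case=> j yE; apply/andP; split.
  have [aj|ja] := leqP a j.
    by have := count_le_all Ha aj; lia.
  by have := count_size (geq j) la; lia.
apply/IH; have [aj|ja] := leqP a j; last by exists j; lia.
exists j.+1; rewrite (@count_le_all la a j.+1 Ha); last lia.
by have := count_le_all Ha aj; lia.
Qed.

Lemma young_diagram_cons a la : young_diagram (a :: la) =
  [seq (0, j) | j <- iota 0 a] ++ [seq (v.1.+1, v.2) | v <- young_diagram la].
Proof.
rewrite /young_diagram /=; congr cat.
rewrite map_flatten -map_comp -(addn0 1) iotaDl -map_comp; congr flatten.
by apply: eq_map => i /=; rewrite -map_comp.
Qed.

Lemma hook_length_consS a la u :
  hook_length (a :: la) (u.1.+1, u.2) = hook_length la u.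
Proof.
rewrite /hook_length /hook young_diagram_cons filter_cat size_cat !size_filter.
rewrite count_map (@eq_count _ _ pred0) ?count_pred0; last first.
  by move=> j /=; rewrite ltn0 andbF.
by rewrite count_map; apply: eq_count => v /=; rewrite eqSS ltnS.
Qed.

Lemma count_iota_ge a j : count (leq j) (iota 0 a) = a - j.
Proof. elim: a => // a IH; rewrite -addn1 iotaD count_cat IH /=; lia. Qed.

Lemma count_iota_eq a j : count (pred1 j) (iota 0 a) = (j < a).
Proof. by rewrite count_uniq_mem ?iota_uniq // mem_iota. Qed.

Lemma count_col la j :
  count (fun v : nat * nat => v.2 == j) (young_diagram la) = count (ltn j) la.
Proof.
elim: la => //= a la IH; rewrite young_diagram_cons count_cat !count_map.
by rewrite -count_iota_eq -IH.
Qed.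

Lemma hook_length_cons0 a la j :
  hook_length (a :: la) (0, j) = a - j + count (ltn j) la.
Proof.
rewrite /hook_length /hook young_diagram_cons filter_cat size_cat !size_filter.
rewrite !count_map -count_col -count_iota_ge; congr (_ + _).
  by apply: eq_count => k /=; lia.
by apply: eq_count => v /=; rewrite andbT.
Qed.

(** The hook length of cell [(0, j)] is [a + size la] minus the position [j + count (geq j) la], so
    hooks of the first row measure distances from the top beta-number down to non-beta-numbers. *)
Lemma is_core_cons t a la : 0 < t -> sorted geq (a :: la) ->
  is_core t (a :: la) =
    is_core t la && ((t <= a + size la) ==> (a + size la - t \in beta la)).
Proof.
move=> t0 sla; have [Ha sla'] := sorted_geq_cons sla.
rewrite /is_core young_diagram_cons all_cat !all_map andbC; congr andb.
  by apply: eq_all => u /=; rewrite hook_length_consS.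
have cnt j : count (ltn j) la + count (geq j) la = size la.
  rewrite addnC -(count_predC (geq j)); congr (_ + _).
  by apply: eq_count => x /=; lia.
apply/allP/idP => [H|/implyP H j].
  apply/implyP => ta; apply/negPn/negP => /(notin_betaP _ sla') [j jE].
  (* Since [0 < t], the missing position lies below [a + size la], so its column meets the first
     row. *)
  have jlt : j < a.
    by have [aj|//] := leqP a j; have := count_le_all Ha aj; lia.
  have /H /= : j \in iota 0 a by rewrite mem_iota.
  by rewrite hook_length_cons0 => /eqP; have := cnt j; lia.
rewrite mem_iota /= hook_length_cons0 => jlt; apply/negP => /eqP E.
have := cnt j => C.
have /H : t <= a + size la by lia.
apply/negP/(notin_betaP _ sla'); exists j; lia.
Qed.

Lemma sorted_geq_beta_lt a la x :
  sorted geq (a :: la) -> x \in beta la -> x < a + size la.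
Proof.
elim: la a => //= b la IH a /andP[ba sl]; rewrite inE => /orP[/eqP->|]; first lia.
by move=> /(IH _ sl); lia.
Qed.

Lemma is_coreP t la : 0 < t -> sorted geq la ->
  reflect {in beta la, forall x, t <= x -> x - t \in beta la} (is_core t la).
Proof.
move=> t0; elim: la => [|a la IH] sla; first by apply: ReflectT.
rewrite is_core_cons //; have [_ sla'] := sorted_geq_cons sla.
apply: (iffP andP) => [[/(IH sla') H1 /implyP H2] x|H].
  rewrite !inE => /orP[/eqP->|xla] tx; first by rewrite H2 // orbT.
  by rewrite H1 ?orbT.
split.
  apply/(IH sla') => x xla tx.
  (* The new beta-number exceeds all the others, so [x - t] cannot be equal to it. *)
  have := H x; rewrite !inE xla orbT => /(_ isT tx).
  by have := sorted_geq_beta_lt sla xla; case: eqP => //; lia.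
apply/implyP => ta; have := H (a + size la); rewrite !inE eqxx => /(_ isT ta).
by case: eqP => //; lia.
Qed.

(** * Distinct parts as gaps between beta-numbers *)

Definition gap : rel nat := fun x y => y.+1 < x.

Fixpoint unbeta (bs : seq nat) : seq nat :=
  if bs is b :: bs' then b - size bs' :: unbeta bs' else [::].

Lemma size_unbeta bs : size (unbeta bs) = size bs.
Proof. by elim: bs => //= a bs ->. Qed.

Lemma betaK : cancel beta unbeta.
Proof. by elim=> //= a la ->; rewrite size_beta addnK. Qed.

(** Ensures that the truncated subtractions in [unbeta] are exact and yield positive parts. *)
Lemma size_lt_head_gap b bs : path gap b bs -> 0 \notin b :: bs -> size bs < b.
Proof.
elim: bs b => [|a bs IH] b /=; first by rewrite inE; lia.
rewrite {1}/gap => /andP[ab /IH H]; rewrite inE negb_or => /andP[_ /H]; lia.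
Qed.

Lemma unbetaK bs : sorted gap bs -> 0 \notin bs -> beta (unbeta bs) = bs.
Proof.
elim: bs => //= b bs IH pb z; rewrite size_unbeta IH ?(path_sorted pb) //.
  by rewrite subnK //; have := size_lt_head_gap pb z; lia.
by move: z; rewrite inE negb_or => /andP[].
Qed.

(** Successive beta-numbers differ by one more than the corresponding parts do. *)
Lemma sorted_gap_beta la : sorted gtn la && (0 \notin la) ->
  sorted gap (beta la) && (0 \notin beta la).
Proof.
elim: la => //= a la IH /andP[pa]; rewrite !inE !negb_or => /andP[a0 z].
have := IH; rewrite (path_sorted pa) z => /(_ isT)/andP[s ->]; rewrite andbT.
apply/andP; split; last lia.
by case: la pa s {IH z} => //= b la /andP[ba _] ->; rewrite /gap andbT; lia.
Qed.

Lemma sorted_gtn_unbeta bs : sorted gap bs && (0 \notin bs) ->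
  sorted gtn (unbeta bs) && (0 \notin unbeta bs).
Proof.
elim: bs => //= b bs IH /andP[pb z]; have := size_lt_head_gap pb z.
move: z; rewrite !inE !negb_or => /andP[b0 z] lb.
have := IH; rewrite (path_sorted pb) z => /(_ isT)/andP[s ->]; rewrite andbT.
apply/andP; split; last lia.
case: bs pb z s {IH b0} lb => //= c bs /andP[cb pc] z -> lb.
rewrite andbT; have := size_lt_head_gap pc z; move: cb; rewrite /gap; lia.
Qed.

Lemma gap_trans : transitive gap.
Proof. by move=> x y z; rewrite /gap; lia. Qed.

Lemma sorted_gapP bs : sorted gtn bs ->
  reflect {in bs, forall x, x.+1 \notin bs} (sorted gap bs).
Proof.
move=> sb; apply: (iffP idP) => [|H].
  elim: bs {sb} => //= b bs IH pb x; have /allP A := order_path_min gap_trans pb.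
  rewrite !inE negb_or => /orP[/eqP->|xb].
    apply/andP; split; first lia.
    by apply/negP => /A; rewrite /gap; lia.
  by rewrite IH ?(path_sorted pb) // andbT; have := A x xb; rewrite /gap; lia.
apply/(sortedP 0) => i ib; have /(sortedP 0) /(_ _ ib) /= lt := sb.
rewrite /gap ltn_neqAle lt andbT; apply/eqP => E.
have := H (nth 0 bs i.+1) (mem_nth 0 ib).
by rewrite E mem_nth // ltnW.
Qed.

(** * The two core conditions combined *)

Definition s_closed s (bs : seq nat) := {in bs, forall x, s <= x -> x - s \in bs}.

Lemma s_closed_sub s bs k x :
  s_closed s bs -> x \in bs -> k * s <= x -> x - k * s \in bs.
Proof.
move=> cl; elim: k x => [|k IH] x xb; first by rewrite subn0.
rewrite mulSn => le; rewrite subnDA; apply: IH; last lia.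
by apply: cl => //; lia.
Qed.

(* If [d * s <= x] then both [x - d * s] and its successor [x - (d * s - 1)]
   would be beta-numbers. *)
Lemma core_bound d s bs : 0 < d -> 0 < s -> 0 \notin bs ->
  {in bs, forall x, x.+1 \notin bs} -> s_closed s bs ->
  s_closed (d * s - 1) bs <-> {in bs, forall x, x < d * s - 1}.
Proof.
move=> d0 s0 z g cl; split=> [cl' x xb|H x /H]; last lia.
rewrite ltnNge; apply/negP => le; have [le'|] := leqP (d * s) x.
  have /g := s_closed_sub cl xb le'.
  suff <- : x - (d * s - 1) = (x - d * s).+1 by rewrite cl'.
  nia.
(* Here [x = d * s - 1], which would make [0] a beta-number. *)
move=> lt; have := cl' x xb le.
suff -> : x - (d * s - 1) = 0 by rewrite (negPf z).
lia.
Qed.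

Lemma distinct_coresP d s la : 0 < d -> 0 < s ->
  distinct_cores d s la <->
  [/\ sorted gap (beta la) && (0 \notin beta la), sorted gtn la && (0 \notin la),
      s_closed s (beta la) & {in beta la, forall x, x < d * s - 1}].
Proof.
move=> d0 s0; rewrite /distinct_cores /= /is_partition /distinct_parts.
have geqW : sorted gtn la -> sorted geq la by apply: sub_sorted => x y /=; lia.
have core1 : sorted gtn la && (0 \notin la) ->
  s_closed s (beta la) -> is_core (d * s - 1) la <->
    {in beta la, forall x, x < d * s - 1}.
  move=> sz cl; have /andP[sg z] := sorted_gap_beta sz.
  have sb : sorted gtn (beta la).
    by apply: sub_sorted sg => x y; rewrite /gap /=; lia.
  have g := sorted_gapP sb sg.
  rewrite -(core_bound d0 s0 z g cl); case/andP: sz => /geqW sl _.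
  (* When [d = s = 1] the modulus is [0], outside the scope of [is_coreP]; then closure is trivial
     and no hook length is [0]. *)
  have [t0|t0] := posnP (d * s - 1); last by split=> /(is_coreP t0 sl).
  rewrite t0; split=> _; first by move=> x xb _; rewrite subn0.
  apply/allP => u uin; rewrite /hook_length -lt0n /hook size_filter -has_count.
  by apply/hasP; exists u => //; rewrite eqxx leqnn.
split=> [[/andP[_ z] sl sc dc]|[_ sz cl B]].
  have sz : sorted gtn la && (0 \notin la) by rewrite sl z.
  have /(is_coreP s0 (geqW sl)) cl := sc.
  by split=> //; [exact: sorted_gap_beta | apply/core1].
have /andP[sl z] := sz; split=> //; first by rewrite geqW.
  exact/(is_coreP s0 (geqW sl)).
exact/core1.
Qed.

(** * Sets of beta-numbers encoded by words *)

(* [c] lists the numbers of beta-numbers in the residue classes 1, ..., s - 1;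
   prepending [0] shifts the index to the residue itself. *)
Definition bset d s (c : seq nat) : seq nat :=
  rev [seq x <- iota 0 (d * s) | x %/ s < nth 0 (0 :: c) (x %% s)].

(** The boolean [i.+1 == size c] counts as [1] and makes the bound strict at the last letter only.
    Past the end [nth] returns [0], so the last letter has no right neighbour to respect. *)
Definition valid d (c : seq nat) := forall i, i < size c ->
  nth 0 c i + (i.+1 == size c) <= d /\ (nth 0 c i = 0 \/ nth 0 c i.+1 = 0).

(** The cut-off at [d * s] loses nothing, as no letter of a valid word exceeds [d]. *)
Lemma mem_bset d s c x : 0 < s -> valid d c ->
  (x \in bset d s c) = (x %/ s < nth 0 (0 :: c) (x %% s)).
Proof.
move=> s0 v; rewrite mem_rev mem_filter mem_iota add0n /=.
case: ltnP => //= lt; rewrite -ltn_divLR //; apply: leq_trans lt _.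
case: (x %% s) => //= i; have [/v[]|/(nth_default 0)->//] := ltnP i (size c).
by lia.
Qed.

Lemma mem_bset_mulD d s c k r : r < s -> valid d c ->
  (k * s + r \in bset d s c) = (k < nth 0 (0 :: c) r).
Proof.
move=> rs v; rewrite mem_bset //; last lia.
by rewrite divnMDl ?modnMDl; [rewrite divn_small // modn_small // addn0|lia].
Qed.

Lemma sorted_bset d s c : sorted gtn (bset d s c).
Proof.
rewrite rev_sorted; apply: (sorted_filter ltn_trans).
exact: iota_ltn_sorted.
Qed.

Lemma sorted_gap_bset d s c : size c = s.-1 -> 0 < s -> valid d c ->
  sorted gap (bset d s c) && (0 \notin bset d s c).
Proof.
move=> sc s0 v; rewrite mem_bset // mod0n div0n ltnn andbT.
apply/sorted_gapP; first exact: sorted_bset.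
move=> x; rewrite (divn_eq x s) -addnS.
move: (x %/ s) (ltn_pmod x s0) => k; case: (x %% s) => [|i] rs.
  by rewrite (mem_bset_mulD k rs v).
rewrite (mem_bset_mulD k rs v) => /= ki.
have [ls|ge] := ltnP i.+2 s.
  rewrite mem_bset_mulD //=; have [|_ []] := v i; lia.
(* The successor of residue [s - 1] falls into class [0], which is empty by the prepended [0]. *)
have -> : k * s + i.+2 = k.+1 * s + 0 by lia.
by rewrite mem_bset_mulD.
Qed.

Lemma s_closed_bset d s c : 0 < s -> valid d c -> s_closed s (bset d s c).
Proof.
move=> s0 v x; rewrite !mem_bset // => lt le.
move: lt; rewrite -{1 2}(subnK le) divnDr // divnn s0 modnDr; lia.
Qed.

Lemma bset_bound d s c : size c = s.-1 -> 0 < s -> valid d c ->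
  {in bset d s c, forall x, x < d * s - 1}.
Proof.
move=> sc s0 v x; rewrite (divn_eq x s).
move: (x %/ s) (ltn_pmod x s0) => k; case: (x %% s) => [|i] rs.
  by rewrite (mem_bset_mulD k rs v).
rewrite mem_bset_mulD //= => ki; have [|+ _] := v i; first lia.
case: eqP; rewrite sc; nia.
Qed.

Lemma distinct_cores_unbeta_bset d s c :
  0 < d -> 0 < s -> size c = s.-1 -> valid d c ->
  distinct_cores d s (unbeta (bset d s c)).
Proof.
move=> d0 s0 sc v; apply/distinct_coresP => //.
have gz := sorted_gap_bset sc s0 v.
rewrite unbetaK; [|by case/andP: gz..].
by split; [|exact: sorted_gtn_unbeta|exact: s_closed_bset|exact: bset_bound].
Qed.

Lemma unbeta_bset_inj d s c c' : 0 < s ->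
  size c = s.-1 -> size c' = s.-1 -> valid d c -> valid d c' ->
  unbeta (bset d s c) = unbeta (bset d s c') -> c = c'.
Proof.
move=> s0 sc sc' v v' /(congr1 beta).
have /andP[g z] := sorted_gap_bset sc s0 v.
have /andP[g' z'] := sorted_gap_bset sc' s0 v'.
rewrite !unbetaK // => E; apply: (@eq_from_nth _ 0); rewrite sc ?sc' // => i ilt.
have is' : i.+1 < s by lia.
have H k : (k < nth 0 c i) = (k < nth 0 c' i).
  by have := mem_bset_mulD k is' v; rewrite E mem_bset_mulD.
have := H (nth 0 c i); have := H (nth 0 c' i); lia.
Qed.

(** A downward closed [P] bounded by [d] is an initial segment, and the count is its length. *)
Lemma ltn_count_iota (P : pred nat) d k :
  (forall k, P k.+1 -> P k) -> (forall k, P k -> k < d) ->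
  (k < count P (iota 0 d)) = P k.
Proof.
move=> dn bd.
have mono i j : i <= j -> P j -> P i.
  by move/subnK<-; elim: (j - i) => // n IH /dn/IH.
(* Cutting at [d] replaces the bound on [P], which would not survive the induction on [d]. *)
suff -> : (k < count P (iota 0 d)) = P k && (k < d).
  by case: (boolP (P k)) => [/bd->|].
elim: d {bd} k => [|d IH] k; first by rewrite ltn0 andbF.
rewrite -[d.+1]addn1 iotaD count_cat /= add0n addn0.
case: (boolP (P d)) => [Pd|nPd]; last first.
  rewrite addn0 IH; case: (boolP (P k)) => //= Pk.
  by have : k != d; [apply: contraNneq nPd => <-|lia].
have -> : count P (iota 0 d) = d.
  have := count_size P (iota 0 d); rewrite size_iota.
  have := IH (count P (iota 0 d)); rewrite ltnn.
  by case: (ltnP (count P (iota 0 d)) d) => [/ltnW/mono->|] //; lia.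
by rewrite !addn1 ltnS andbC; case: (leqP k d) => // /mono->.
Qed.

Lemma distinct_cores_bset d s la : 0 < d -> 0 < s -> distinct_cores d s la ->
  exists2 c, size c = s.-1 /\ valid d c & la = unbeta (bset d s c).
Proof.
move=> d0 s0 /distinct_coresP -/(_ d0 s0) [/andP[sg z] _ cl B].
have sb : sorted gtn (beta la).
  by apply: sub_sorted sg => x y; rewrite /gap /=; lia.
have g := sorted_gapP sb sg.
pose m r := count (fun k => k * s + r \in beta la) (iota 0 d).
pose c := [seq m r | r <- iota 1 s.-1].
have sc : size c = s.-1 by rewrite size_map size_iota.
have ltm r k : (k < m r) = (k * s + r \in beta la).
  apply: (@ltn_count_iota (fun k => k * s + r \in beta la)) => {}k H.
    suff -> : k * s + r = k.+1 * s + r - s by apply: cl => //; lia.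
    lia.
  have := B _ H; nia.
have m0 : m 0 = 0.
  case E: (m 0) => [//|n].
  by have := ltm 0 0; rewrite E (negPf z).
have nthc r : r < s -> nth 0 (0 :: c) r = m r.
  case: r => [|r] rs; first by rewrite m0.
  rewrite /= (nth_map 0) ?size_iota ?nth_iota; [by rewrite add1n|lia..].
have v : valid d c.
  move=> i; rewrite sc => ilt; split.
    have -> : nth 0 c i = m i.+1 by rewrite -nthc //; lia.
    have : m i.+1 <= d by rewrite -[d in _ <= d](size_iota 0) count_size.
    case: eqP => E; last lia.
    (* In the last class, with [i.+1 = s - 1], this number is [d * s - 1], the first one excluded by
       [B]. *)
    have := ltm i.+1 d.-1; have : d.-1 * s + i.+1 \notin beta la.
      by apply/negP => /B; nia.
    by move/negPf->; lia.
  have -> : nth 0 c i = m i.+1 by rewrite -nthc //; lia.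
  have [ls|ge] := ltnP i.+2 s; last by right; rewrite nth_default //; lia.
  have -> : nth 0 c i.+1 = m i.+2 by rewrite -nthc //; lia.
  (* A nonzero count puts the residue itself among the beta-numbers, so two adjacent nonzero counts
     would give consecutive ones. *)
  have := ltm i.+1 0; have := ltm i.+2 0; rewrite !mul0n !add0n.
  by case: (boolP (i.+1 \in beta la)) => [/g/negPf->|_]; lia.
exists c => //; rewrite -[la in LHS]betaK; congr unbeta.
apply: (@irr_sorted_eq _ gtn) => //; [|exact: ltnn|exact: sorted_bset|].
  by move=> x y w /=; lia.
move=> x; have rs := ltn_pmod x s0; rewrite (divn_eq x s) mem_bset_mulD //.
by rewrite nthc // ltm.
Qed.

(** * Enumeration of the valid words *)

(** A sole letter is also the last one, hence below [d]. In a longer word a nonzero first letter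
    takes the values [1, ..., d] and forces a [0] after it, which leaves the rest free. *)
Fixpoint codes d n : seq (seq nat) :=
  if n is n1.+1 then
    if n1 is n2.+1 then
      [seq 0 :: c | c <- codes d n1] ++
      [seq x :: 0 :: c | x <- iota 1 d, c <- codes d n2]
    else [seq [:: x] | x <- iota 0 d]
  else [:: [::]].

Lemma valid_cons0 d c : 0 < d -> valid d (0 :: c) <-> valid d c.
Proof.
move=> d0; split=> [H i|H [|i]] ilt /=; first exact: (H i.+1).
  (* If the prepended [0] is itself the last letter, its bound reads [1 <= d]. *)
  by split; [case: eqP; lia|left].
exact: H.
Qed.

Lemma valid_consS d x y c :
  valid d (x.+1 :: y :: c) <-> [/\ x < d, y = 0 & valid d (y :: c)].
Proof.
split=> [H|[xd -> H] [|i]] /=; last 2 first.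
- by move=> _; split; [lia|right].
- exact: H.
have [//|/= + []//] := H 0; rewrite addn0 => xd y0.
by split=> // i; apply: (H i.+1).
Qed.

Lemma codesP d n c : 0 < d ->
  (c \in codes d n) <-> (size c = n /\ valid d c).
Proof.
move=> d0; elim/ltn_ind: n c => -[|[|n]] IH c.
- by rewrite inE; split=> [/eqP->//|[/size0nil->]].
- split=> [/mapP[x]|[]].
    rewrite mem_iota => xd ->; split=> // -[|//] _ /=; split; [lia|by right].
  case: c => [//|x [|//]] _ /(_ 0 isT) [/= xd _]; apply/mapP; exists x => //.
  by rewrite mem_iota; lia.
have {IH} [IH0 IH1] : (forall c, c \in codes d n <-> size c = n /\ valid d c) /\
    (forall c, c \in codes d n.+1 <-> size c = n.+1 /\ valid d c).
  by split; apply: IH; lia.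
rewrite [codes _ _]/= -/(codes d n.+1) mem_cat; split.
  case/orP=> [/mapP[c' /IH1[sc v] ->]|].
    by rewrite /= sc; split=> //; apply/valid_cons0.
  case/allpairsP=> [[x c'] /= [xd /IH0[sc v] ->]].
  rewrite /= sc; split=> //; move: xd; rewrite mem_iota.
  by case: x => // x xd; apply/valid_consS; split=> //; apply/valid_cons0.
case: c => [[]//|[|x] c] [[sc]].
  move=> /(valid_cons0 _ d0) v; apply/orP; left; apply/mapP; exists c => //.
  exact/IH1.
case: c sc => [//|y c] [sc] /valid_consS [xd -> /(valid_cons0 _ d0) v].
apply/orP; right; apply/allpairsP; exists (x.+1, c); split=> //=.
  by rewrite mem_iota; lia.
exact/IH0.
Qed.

Lemma uniq_codes d n : uniq (codes d n).
Proof.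
elim/ltn_ind: n => -[|[|n]] IH //.
  by rewrite map_inj_uniq ?iota_uniq // => x y [].
rewrite [codes _ _]/= -/(codes d n.+1) cat_uniq; apply/and3P; split.
- by rewrite map_inj_uniq ?IH // => x y [].
- apply/hasPn => c /allpairsP[[x c'] /= [+ _ ->]]; rewrite mem_iota => x0.
  by apply/mapP => -[c'' _ [E]]; rewrite E in x0.
- apply: allpairs_uniq; [exact: iota_uniq|exact: IH|].
  by move=> [x c1] [y c2] _ _ /= [-> ->].
Qed.

Lemma size_codesSS d n :
  size (codes d n.+2) = size (codes d n.+1) + d * size (codes d n).
Proof. by rewrite [codes _ _]/= size_cat size_map size_allpairs size_iota. Qed.

(** * Finiteness and the recurrence *)

(** Serves both finiteness and the computation of [N] through [fset_set]. *)
Lemma distinct_coresE d s : 0 < d -> 0 < s ->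
  distinct_cores d s =
  [set` [fset la in [seq unbeta (bset d s c) | c <- codes d s.-1]]%fset]%classic.
Proof.
move=> d0 s0; apply/seteqP; split=> la /=; rewrite inE /=.
  case/(distinct_cores_bset d0 s0) => c /(codesP _ _ d0) cin ->.
  exact: map_f.
by case/mapP=> c /(codesP _ _ d0) [sc v] ->; apply: distinct_cores_unbeta_bset.
Qed.

Lemma N_codes d s : 0 < d -> 0 < s -> N d s = size (codes d s.-1).
Proof.
move=> d0 s0; rewrite /N distinct_coresE // set_fsetK card_fseq undup_id ?size_map //.
rewrite map_inj_in_uniq ?uniq_codes // => c c'.
move=> /(codesP _ _ d0)[sc v] /(codesP _ _ d0)[sc' v'].
exact: unbeta_bset_inj.
Qed.

Unset Implicit Arguments.

Theorem theorem3 (d : nat) (hd : 1 <= d) :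
  (forall s : nat, 1 <= s -> finite_set (distinct_cores d s)) /\
  N d 1 = 1 /\
  N d 2 = d /\
  (forall s : nat, 3 <= s -> N d s = N d (s - 1) + d * N d (s - 2)).
Proof.
split; first by move=> s hs; rewrite distinct_coresE //; apply: finite_fset.
do !split; [by rewrite N_codes|by rewrite N_codes //= size_map size_iota|].
(* For [s = n.+3] the words involved have lengths [n.+2], [n.+1] and [n]. *)
case=> [|[|[|n]]] // _; rewrite !subSS !subn0 !N_codes //; exact: size_codesSS.
Qed.
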